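(* For $g\in\mathcal{F}_0$ and $f_1,f_2\in\mathcal{F}_1$, the triple $\big(g(z^2),\tfrac{f_1(z^2)}{z},\tfrac{f_2(z^2)}{z}\big)$ is a Double Riordan array (and every Double Riordan array has this form). The map $\chi$ from the Double Riordan group to the Triple Riordan group defined by \[ \chi\Big(g(z^2),\tfrac{f_1(z^2)}{z},\tfrac{f_2(z^2)}{z}\Big)=\Big(g(z^3),\ z,\ \tfrac{f_1(z^3)}{z^2},\ \tfrac{f_2(z^3)}{z^2}\Big) \] is a group monomorphism. Consequently the Double Riordan group is isomorphic to the type-1 almost Appell subgroup of the Triple Riordan group. The Double Riordan group is also isomorphic to the type-2 and to the type-3 almost Appell subgroups of the Triple Riordan group.
   Context: Work with formal power series in $z$ over $\mathbb{C}$. Let $\mathcal{F}_0$ be the set of formal power series with nonzero constant term, and $\mathcal{F}_1$ the set of formal power series with zero constant term and nonzero coefficient of $z$. For $k\ge1$, a $k$-Riordan array $(g,f_1,\dots,f_k)$ consists of $g(z)=\tilde g(z^k)$ with $\tilde g\in\mathcal{F}_0$ and $f_i(z)=\hat f_i(z^k)/z^{k-1}$ with $\hat f_i\in\mathcal{F}_1$; it is the infinite lower-triangular matrix whose column $0$ has generating function $g$ and whose column $n\ge1$ has generating function $g\prod_{m=1}^{n} f_{((m-1)\bmod k)+1}$ (multiplier functions applied cyclically). The $k$-Riordan group is the set of these arrays under matrix multiplication, given by $(g,f_1,\dots,f_k)*(G,F_1,\dots,F_k)=\big(g\,G(h),\ \tfrac{f_1}{h}F_1(h),\dots,\tfrac{f_k}{h}F_k(h)\big)$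 where $h\in\mathcal{F}_1$ satisfies $h^k=f_1\cdots f_k$ (independent of the choice of root). For $k=2$ this is the Double Riordan group (arrays $(g,f_1,f_2)$ with $g$ even, $f_1,f_2$ odd), for $k=3$ the Triple Riordan group. The type-1, type-2, type-3 almost Appell subgroups of the Triple Riordan group are, respectively, the sets of $3$-Riordan arrays $\big(g(z^3),z,\tfrac{f_1(z^3)}{z^2},\tfrac{f_2(z^3)}{z^2}\big)$, $\big(g(z^3),\tfrac{f_1(z^3)}{z^2},z,\tfrac{f_2(z^3)}{z^2}\big)$, $\big(g(z^3),\tfrac{f_1(z^3)}{z^2},\tfrac{f_2(z^3)}{z^2},z\big)$ with $g\in\mathcal{F}_0$, $f_1,f_2\in\mathcal{F}_1$ (i.e. the multiplier function $z$ is placed in the first, second or third position). *)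

(* Defs.v *)
From HB Require Import structures.
From mathcomp Require Import all_boot all_order all_algebra.
From mathcomp Require Import boolp.

Set Implicit Arguments.
Unset Strict Implicit.
Unset Printing Implicit Defensive.

Import GRing.Theory.
Local Open Scope ring_scope.

Section FormalPowerSeries.
Variable F : fieldType.

(* The coercion makes [f n] the coefficient of z^n. *)
Record fps := Fps { fcoef :> nat -> F }.

HB.instance Definition _ := gen_eqMixin fps.
HB.instance Definition _ := gen_choiceMixin fps.

Lemma fpsP (f g : fps) : (forall n, f n = g n) -> f = g.
Proof. by case: f g => [f] [g] /= /funext ->. Qed.

Definition fps_add (f g : fps) := Fps (fun n => f n + g n).
Definition fps_opp (f : fps) := Fps (fun n => - f n).
Definition fps_mul (f g : fps) :=
  Fps (fun n => \sum_(i < n.+1) f i * g (n - i)%N).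
Definition fps_const (c : F) := Fps (fun n => if n is 0%N then c else 0).

Fact fps_addA : associative fps_add.
Proof. by move=> f g h; apply: fpsP => n /=; rewrite addrA. Qed.
Fact fps_addC : commutative fps_add.
Proof. by move=> f g; apply: fpsP => n /=; rewrite addrC. Qed.
Fact fps_add0 : left_id (fps_const 0) fps_add.
Proof. by move=> f; apply: fpsP => -[|n] /=; rewrite add0r. Qed.
Fact fps_addN : left_inverse (fps_const 0) fps_opp fps_add.
Proof. by move=> f; apply: fpsP => -[|n] /=; rewrite addNr. Qed.

HB.instance Definition _ :=
  GRing.isZmodule.Build fps fps_addA fps_addC fps_add0 fps_addN.

(* [agree n p f]: the polynomial p is congruent to f modulo z^n; power series
   identities are reduced below to polynomial ones. *)
Definition agree n (p : {poly F}) (f : fps) := forall i, (i < n)%N -> p`_i = f i.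

Definition trunc n (f : fps) : {poly F} := \poly_(i < n) f i.

Lemma agree_trunc n f : agree n (trunc n f) f.
Proof. by move=> i lt_in; rewrite coef_poly lt_in. Qed.

Lemma agree_eq f g :
  (forall n, exists p, agree n.+1 p f /\ agree n.+1 p g) -> f = g.
Proof. by move=> H; apply: fpsP => n; have [p [Hf Hg]] := H n; rewrite -Hf ?Hg. Qed.

Lemma agree_add n p q f g :
  agree n p f -> agree n q g -> agree n (p + q) (fps_add f g).
Proof. by move=> Hf Hg i lt_in; rewrite coefD Hf // Hg. Qed.

Lemma agree_mul n p q f g :
  agree n p f -> agree n q g -> agree n (p * q) (fps_mul f g).
Proof.
move=> Hf Hg i lt_in; rewrite coefM; apply: eq_bigr => j _.
rewrite Hf ?Hg //; first exact: leq_ltn_trans (leq_subr _ _) lt_in.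
by apply: leq_trans lt_in; apply: ltn_ord.
Qed.

Lemma agree_const n c : agree n c%:P (fps_const c).
Proof. by move=> [|i] _; rewrite coefC. Qed.

Fact fps_mulA : associative fps_mul.
Proof.
move=> f g h; apply: agree_eq => n.
have [Hf Hg] := (@agree_trunc n.+1 f, @agree_trunc n.+1 g).
have Hh := @agree_trunc n.+1 h.
exists (trunc n.+1 f * (trunc n.+1 g * trunc n.+1 h)); split; last rewrite mulrA.
  exact: agree_mul Hf (agree_mul Hg Hh).
exact: agree_mul (agree_mul Hf Hg) Hh.
Qed.
Fact fps_mulC : commutative fps_mul.
Proof.
move=> f g; apply: agree_eq => n.
have [Hf Hg] := (@agree_trunc n.+1 f, @agree_trunc n.+1 g).
exists (trunc n.+1 f * trunc n.+1 g); split; last rewrite mulrC.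
  exact: agree_mul Hf Hg.
exact: agree_mul Hg Hf.
Qed.
Fact fps_mul1 : left_id (fps_const 1) fps_mul.
Proof.
move=> f; apply: agree_eq => n; have Hf := @agree_trunc n.+1 f.
exists (1%:P * trunc n.+1 f); split; last by rewrite mul1r.
exact: agree_mul (@agree_const _ 1) Hf.
Qed.
Fact fps_mulDl : left_distributive fps_mul fps_add.
Proof.
move=> f g h; apply: agree_eq => n.
have [Hf Hg] := (@agree_trunc n.+1 f, @agree_trunc n.+1 g).
have Hh := @agree_trunc n.+1 h.
exists ((trunc n.+1 f + trunc n.+1 g) * trunc n.+1 h); split; last rewrite mulrDl.
  exact: agree_mul (agree_add Hf Hg) Hh.
exact: agree_add (agree_mul Hf Hh) (agree_mul Hg Hh).
Qed.
Fact fps_1neq0 : fps_const 1 != 0.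
Proof.
apply/eqP => /(congr1 (fun f : fps => f 0%N)) /= /eqP.
by rewrite (oner_eq0 F).
Qed.

HB.instance Definition _ :=
  GRing.Zmodule_isComNzRing.Build fps
    fps_mulA fps_mulC fps_mul1 fps_mulDl fps_1neq0.

Definition zvar : fps := Fps (fun n => (n == 1)%N%:R).

(* f(h); for h 0 = 0 (the only meaningful case) the terms with i > n of
   sum_i f_i h^i do not contribute to z^n. *)
Definition fps_comp (f h : fps) :=
  Fps (fun n => \sum_(i < n.+1) f i * (h ^+ i) n).

(* f(z) / z^m, an exact division when z^m divides f. *)
Definition fps_divz (m : nat) (f : fps) := Fps (fun n => f (n + m)%N).

Definition fpsF0 (f : fps) : Prop := f 0%N != 0.
Definition fpsF1 (f : fps) : Prop := f 0%N = 0 /\ f 1%N != 0.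

Lemma agree_exp n p (f : fps) i : agree n p f -> agree n (p ^+ i) (f ^+ i).
Proof.
move=> Hp; elim: i => [|i IHi]; first by rewrite !expr0 -polyC1; exact: agree_const.
by rewrite !exprS; exact: agree_mul.
Qed.

Lemma coefM0 (f g : fps) : (f * g) 0%N = f 0%N * g 0%N.
Proof. by rewrite [LHS]/= big_ord1. Qed.

Lemma coefE0 (f : fps) i : (f ^+ i) 0%N = f 0%N ^+ i.
Proof. by elim: i => [|i IHi]; rewrite ?expr0 // !exprS coefM0 IHi. Qed.

Lemma coef_prod0 (I : Type) (r : seq I) (P : pred I) (f : I -> fps) :
  (\prod_(i <- r | P i) f i) 0%N = \prod_(i <- r | P i) f i 0%N.
Proof. by apply: (big_morph (fun f : fps => f 0%N)) => // f1 f2; apply: coefM0. Qed.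

Lemma coefzM (u : fps) n : (zvar * u) n = if n is m.+1 then u m else 0.
Proof.
case: n => [|n]; first by rewrite coefM0 mul0r.
rewrite [LHS]/= big_ord_recl mul0r add0r big_ord_recl mul1r subSS subn0.
by rewrite big1 ?addr0 // => i _; rewrite mul0r.
Qed.

Lemma coefzXM k (u : fps) n :
  (zvar ^+ k * u) n = if (k <= n)%N then u (n - k)%N else 0.
Proof.
elim: k n => [|k IHk] n; first by rewrite expr0 mul1r subn0.
by rewrite exprS -mulrA coefzM; case: n => [|n] //; rewrite IHk.
Qed.

Lemma coefzX k n : (zvar ^+ k) n = (n == k)%:R.
Proof.
rewrite -[zvar ^+ k]mulr1 coefzXM; case: (leqP k n) => [le_kn|/ltn_eqF-> //].
by rewrite eqn_leq le_kn andbT -subn_eq0; case: (n - k)%N.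
Qed.

Lemma fps_zP (f : fps) : f 0%N = 0 -> f = zvar * fps_divz 1 f.
Proof. by move=> f0; apply: fpsP => -[|n]; rewrite coefzM //= addn1. Qed.

Lemma zvar_inj : injective (fun u : fps => zvar * u).
Proof. by move=> u v /= E; apply: fpsP => n; rewrite -[u n](coefzM u n.+1) E coefzM. Qed.

Lemma coefX_lt (h : fps) i n : h 0%N = 0 -> (n < i)%N -> (h ^+ i) n = 0.
Proof. by move=> /fps_zP -> lt_ni; rewrite exprMn coefzXM leqNgt lt_ni. Qed.

Lemma sum_widen (G : nat -> F) a b : (forall j, (a <= j)%N -> G j = 0) ->
  (forall j, (b <= j)%N -> G j = 0) -> \sum_(j < a) G j = \sum_(j < b) G j.
Proof.
have W c d : (forall j, (c <= j)%N -> G j = 0) ->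
    \sum_(j < c + d) G j = \sum_(j < c) G j.
  move=> Gc; elim: d => [|d IHd]; first by rewrite addn0.
  by rewrite addnS big_ord_recr /= IHd Gc ?leq_addr // addr0.
by move=> /(W a b) <- /(W b a) <-; rewrite addnC.
Qed.

Lemma agree_comp n p q (f h : fps) : h 0%N = 0 ->
  agree n p f -> agree n q h -> agree n (p \Po q) (fps_comp f h).
Proof.
move=> h0 Hp Hq i lt_in; rewrite comp_polyE coef_sum.
have Hc j : (q ^+ j)`_i = (h ^+ j) i by apply: (agree_exp j Hq).
under eq_bigr do rewrite coefZ Hc.
rewrite (@sum_widen (fun j => p`_j * (h ^+ j) i) _ i.+1) /=.
- by apply: eq_bigr => j _; rewrite Hp // (leq_trans (ltn_ord j)).
- by move=> j /(nth_default 0) ->; rewrite mul0r.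
- by move=> j lt_ij; rewrite coefX_lt ?mulr0.
Qed.

Lemma comp_coef0 (f h : fps) : fps_comp f h 0%N = f 0%N.
Proof. by rewrite [LHS]/= big_ord1 mulr1. Qed.

Lemma fps_compM (f g h : fps) : h 0%N = 0 ->
  fps_comp (f * g) h = fps_comp f h * fps_comp g h.
Proof.
move=> h0; apply: agree_eq => n.
have [Hf Hg] := (@agree_trunc n.+1 f, @agree_trunc n.+1 g).
have Hh := @agree_trunc n.+1 h.
exists ((trunc n.+1 f * trunc n.+1 g) \Po trunc n.+1 h); split.
  exact: agree_comp h0 (agree_mul Hf Hg) Hh.
by rewrite comp_polyM; apply: agree_mul; exact: agree_comp.
Qed.

Lemma fps_compA (f g h : fps) : g 0%N = 0 -> h 0%N = 0 ->
  fps_comp (fps_comp f g) h = fps_comp f (fps_comp g h).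
Proof.
move=> g0 h0; apply: agree_eq => n.
have [Hf Hg] := (@agree_trunc n.+1 f, @agree_trunc n.+1 g).
have Hh := @agree_trunc n.+1 h.
exists (trunc n.+1 f \Po (trunc n.+1 g \Po trunc n.+1 h)); split.
  by rewrite comp_polyA; do 2?apply: agree_comp.
by do 2?apply: agree_comp => //; rewrite comp_coef0.
Qed.

Lemma fps_comp1 (h : fps) : fps_comp 1 h = 1.
Proof.
apply: fpsP => n; rewrite [LHS]/= big_ord_recl mul1r big1 => [|i _].
  by rewrite addr0 expr0.
by rewrite mul0r.
Qed.

Lemma fps_compX (f h : fps) i : h 0%N = 0 ->
  fps_comp (f ^+ i) h = fps_comp f h ^+ i.
Proof.
by move=> h0; elim: i => [|i IHi]; rewrite ?expr0 ?fps_comp1 // !exprS fps_compM // IHi.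
Qed.

Lemma fps_comp_prod (h : fps) n (f : nat -> fps) : h 0%N = 0 ->
  fps_comp (\prod_(i < n) f i) h = \prod_(i < n) fps_comp (f i) h.
Proof.
move=> h0; apply: (big_morph (fun f => fps_comp f h)); last exact: fps_comp1.
by move=> f1 f2; rewrite fps_compM.
Qed.

Lemma fps_compz (h : fps) : h 0%N = 0 -> fps_comp zvar h = h.
Proof.
move=> h0; apply: fpsP => -[|n] /=; first by rewrite big_ord1 mul0r h0.
rewrite big_ord_recl mul0r add0r big_ord_recl mul1r expr1.
by rewrite big1 ?addr0 // => i _; rewrite mul0r.
Qed.

Lemma tri_solve (T : nat -> nat -> F) (u : nat -> F) :
  (forall n, T n n != 0) ->
  exists w : nat -> F, forall n, \sum_(i < n.+1) w i * T n i = u n.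
Proof.
move=> T0.
pose next s := (u (size s) - \sum_(i < size s) s`_i * T (size s) i)
               / T (size s) (size s).
pose b n := iter n (fun s => rcons s (next s)) [::].
have sb n : size (b n) = n by elim: n => //= n IHn; rewrite size_rcons IHn.
have bS n i : (i < n)%N -> (b n)`_i = (b i.+1)`_i.
  elim: n => // n IHn; rewrite ltnS leq_eqVlt => /predU1P[-> //|lt_in].
  by rewrite [b n.+1]/= nth_rcons sb lt_in IHn.
exists (fun n => (b n.+1)`_n) => n; rewrite big_ord_recr /= nth_rcons sb ltnn eqxx.
rewrite /next sb divfK //; under eq_bigr => i _ do rewrite -(bS n) //.
by rewrite addrC subrK.
Qed.

Lemma fps_inv_ex (f : fps) : fpsF0 f -> exists w : fps, f * w = 1.
Proof.
move=> f0; have [|w Hw] := @tri_solve (fun n i => f (n - i)%N) (1 : fps).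
  by move=> n; rewrite subnn.
by exists (Fps w); rewrite mulrC; apply: fpsP => n; apply: Hw.
Qed.

Lemma fps_comp_surj (h u : fps) : fpsF1 h -> exists w, fps_comp w h = u.
Proof.
case=> h0 h1; have [|w Hw] := @tri_solve (fun n i => (h ^+ i) n) u.
  move=> n; rewrite (fps_zP h0) exprMn coefzXM leqnn subnn coefE0.
  by rewrite expf_neq0.
by exists (Fps w); apply: fpsP.
Qed.

Lemma fps_F1_cancel (h : fps) : fpsF1 h -> injective (fun u => h * u).
Proof.
case=> h0 h1 u v /=; rewrite (fps_zP h0) -!mulrA => /zvar_inj E.
have [|w Hw] := @fps_inv_ex (fps_divz 1 h); first exact: h1.
by rewrite -[u]mul1r -[v]mul1r -Hw mulrC mulrA [u * _]mulrC E mulrC mulrA [w * _]mulrC.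
Qed.

(* g(z^k) and f(z^k) / z^(k-1) *)
Definition kseries k (g : fps) := fps_comp g (zvar ^+ k).
Definition kmult k (f : fps) := fps_divz k.-1 (fps_comp f (zvar ^+ k)).

End FormalPowerSeries.

Section RiordanArrays.
Variable F : fieldType.
Implicit Types (g h : fps F).

Definition is_kRiordan k g (f : k.-tuple (fps F)) : Prop :=
  (exists2 g0 : fps F, fpsF0 g0 & g = kseries k g0) /\
  (forall i : 'I_k,
     exists2 f0 : fps F, fpsF1 f0 & tnth f i = kmult k f0).

(* Multipliers are numbered from 0, so that f_(((m-1) mod k)+1) is
   f`_(m.-1 %% k). *)
Definition riordan_col k g (f : k.-tuple (fps F)) (n : nat) : fps F :=
  g * \prod_(m < n) f`_(m %% k).

Definition riordan_mx k g (f : k.-tuple (fps F)) : nat -> nat -> F :=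
  fun i j => riordan_col g f j i.

(* Product of infinite matrices, the left one being lower triangular: the
   terms with l > i vanish. *)
Definition ltmx_mul (A B : nat -> nat -> F) : nat -> nat -> F :=
  fun i j => \sum_(l < i.+1) A i l * B l j.

Definition ltmx_id : nat -> nat -> F := fun i j => (i == j)%:R.

Lemma zX0 k : (0 < k)%N -> (zvar F ^+ k) 0%N = 0.
Proof. by case: k => // k _; rewrite coefzX. Qed.

Lemma coef_kseries k (f : fps F) p s : (s < k)%N ->
  kseries k f (p * k + s)%N = if s == 0%N then f p else 0.
Proof.
move=> lt_sk; have k_gt0 : (0 < k)%N by apply: leq_trans lt_sk.
rewrite [LHS]/=; under eq_bigr do rewrite -exprM coefzX.
case: eqVneq => [->|s_neq0].
  rewrite addn0 mulnC; have lt_p : (p < (k * p).+1)%N by rewrite ltnS leq_pmull.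
  rewrite (bigD1 (Ordinal lt_p)) //= eqxx mulr1 big1 ?addr0 // => i.
  by rewrite -val_eqE /= eqn_pmul2l // eq_sym => /negPf ->; rewrite mulr0.
rewrite big1 // => i _; case: eqP => [E|]; rewrite ?mulr0 //.
have := congr1 (modn^~ k) E; rewrite modnMDl modn_small // modnMr => s0.
by rewrite s0 in s_neq0.
Qed.

Lemma coef_zkseries k (f : fps F) p r s : (r < k)%N -> (s < k)%N ->
  (zvar F ^+ r * kseries k f) (p * k + s)%N = if s == r then f p else 0.
Proof.
move=> lt_rk lt_sk; rewrite coefzXM; case: (leqP r s) => [le_rs|lt_sr].
  rewrite (leq_trans le_rs (leq_addl _ _)) -addnBA // coef_kseries.
    by rewrite subn_eq0 eqn_leq le_rs andbT.
  exact: leq_ltn_trans (leq_subr _ _) lt_sk.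
rewrite (ltn_eqF lt_sr); case: p => [|p]; first by rewrite leqNgt lt_sr.
case: ifP => // _; rewrite mulSnr -addnA -addnBA; last first.
  by rewrite (leq_trans (ltnW lt_rk)) ?leq_addr.
have lt_k : (k + s - r < k)%N.
  by rewrite ltn_psubLR ?(leq_ltn_trans _ lt_rk) // addnC ltn_add2r.
by rewrite coef_kseries // subn_eq0 leqNgt (leq_trans lt_rk) ?leq_addr.
Qed.

Lemma kmultE k (f : fps F) : (0 < k)%N -> f 0%N = 0 ->
  kmult k f = zvar F * kseries k (fps_divz 1 f).
Proof.
move=> k_gt0 f0; rewrite /kmult {1}(fps_zP f0) fps_compM ?fps_compz ?zX0 //.
case: k k_gt0 => // k _; apply: fpsP => n; rewrite [LHS]coefzXM coefzM.
case: n => [|n]; first by rewrite add0n ltnn.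
by rewrite addSn ltnS leq_addl subSS addnK.
Qed.

Lemma kmult_z k (u : fps F) : (0 < k)%N ->
  kmult k (zvar F * u) = zvar F * kseries k u.
Proof.
move=> k_gt0; rewrite kmultE ?coefzM //; congr (_ * kseries _ _).
by apply: fpsP => n; rewrite -[LHS]/((zvar F * u) (n + 1)%N) addn1 coefzM.
Qed.

(* Up to [kseries], k-Riordan arrays are parametrized by c, w_0, ..., w_(k-1)
   in F_0, through g = c(z^k) and f_i = z w_i(z^k); the multiplication rule
   then involves h^k = hk(z^k) with hk = z w_0 ... w_(k-1), but no k-th root. *)
Definition wmult k (w : nat -> fps F) : k.-tuple (fps F) :=
  [tuple zvar F * kseries k (w i) | i < k].
Definition hk k (w : nat -> fps F) : fps F := zvar F * \prod_(m < k) w m.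

Lemma is_kRiordanP k g (f : k.-tuple (fps F)) : (0 < k)%N -> is_kRiordan g f <->
  exists c w, [/\ fpsF0 c, forall m, fpsF0 (w m), g = kseries k c & f = wmult k w].
Proof.
move=> k_gt0; split=> [[[c c0 gE]] fE|[c [w [c0 w0 gE fE]]]]; last first.
  split; first by exists c.
  move=> i; exists (zvar F * w i).
    by split; rewrite coefzM //; apply: w0.
  by rewrite kmult_z // fE tnth_mktuple.
have /choice[u uE] : forall i : 'I_k, exists u : fps F,
    fpsF0 u /\ tnth f i = zvar F * kseries k u.
  move=> i; have [f0 [f00 f01] fi] := fE i; exists (fps_divz 1 f0).
  by split=> //; rewrite fi kmultE.
pose w m := u (insubd (Ordinal k_gt0) m).
exists c, w; split=> // [m|]; first by case: (uE (insubd (Ordinal k_gt0) m)).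
apply: eq_from_tnth => i; rewrite tnth_mktuple /w.
have -> : insubd (Ordinal k_gt0) i = i by apply: val_inj; rewrite val_insubd ltn_ord.
by case: (uE i).
Qed.

Lemma wmultE k w m : (m < k)%N -> (wmult k w)`_m = zvar F * kseries k (w m).
Proof. by move=> lt_mk; rewrite -[m]/(val (Ordinal lt_mk)) -tnth_nth tnth_mktuple. Qed.

Lemma prod_modn k (f : nat -> fps F) q r : (r < k)%N ->
  \prod_(m < q * k + r) f (m %% k)%N
    = (\prod_(m < k) f m) ^+ q * \prod_(m < r) f m.
Proof.
move=> lt_rk; elim: q => [|q IHq].
  rewrite expr0 mul1r; apply: eq_bigr => i _; rewrite modn_small //.
  exact: ltn_trans lt_rk.
rewrite mulSn -addnA big_split_ord /= exprS -mulrA; congr (_ * _).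
  by apply: eq_bigr => i _; rewrite modn_small.
by rewrite -IHq; apply: eq_bigr => i _; rewrite modnDl.
Qed.

Lemma coef_hk0 k w : hk k w 0%N = 0. Proof. by rewrite coefzM. Qed.

Lemma coef_wmx k c w p q r s : (r < k)%N -> (s < k)%N ->
  riordan_mx (kseries k c) (wmult k w) (p * k + s) (q * k + r)
    = if s == r then (c * (\prod_(m < r) w m) * hk k w ^+ q) p else 0.
Proof.
move=> lt_rk lt_sk; have k_gt0 : (0 < k)%N by apply: leq_ltn_trans lt_rk.
have z0 := zX0 k_gt0.
rewrite /riordan_mx /riordan_col (prod_modn (fun m => (wmult k w)`_m)) //.
have E n : (n <= k)%N -> \prod_(m < n) (wmult k w)`_m
    = zvar F ^+ n * kseries k (\prod_(m < n) w m).
  move=> le_nk; rewrite /kseries fps_comp_prod //.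
  rewrite -[in zvar F ^+ n](card_ord n) -prodr_const -big_split /=.
  by apply: eq_bigr => i _; rewrite wmultE // (leq_trans (ltn_ord i)).
rewrite !E ?(ltnW lt_rk) // -(coef_zkseries _ _ lt_rk lt_sk); congr (fcoef _ _).
rewrite /kseries /hk !fps_compM // fps_compX // fps_compM // fps_compz //.
by rewrite [RHS]mulrC -!mulrA; congr (_ * _); rewrite [RHS]mulrC -mulrA.
Qed.

Lemma coefM_comp (C D h : fps F) n : h 0%N = 0 ->
  (C * fps_comp D h) n = \sum_(a < n.+1) (C * h ^+ a) n * D a.
Proof.
move=> h0; rewrite [LHS]/=; under [RHS]eq_bigr do rewrite big_distrl /=.
rewrite exchange_big /=; apply: eq_bigr => i _.
rewrite (@sum_widen F (fun a => D a * (h ^+ a) (n - i)%N) _ n.+1).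
- by rewrite mulr_sumr; apply: eq_bigr => a _; rewrite mulrA mulrAC.
- by move=> a lt_a; rewrite coefX_lt ?mulr0.
move=> a lt_a; rewrite coefX_lt ?mulr0 //; apply: leq_ltn_trans lt_a.
exact: leq_subr.
Qed.

Definition wmul k (w v : nat -> fps F) m := w m * fps_comp (v m) (hk k w).

Lemma hk_mul k w v : hk k (wmul k w v) = fps_comp (hk k v) (hk k w).
Proof.
rewrite [in RHS]/hk fps_compM ?fps_compz ?coef_hk0 // fps_comp_prod ?coef_hk0 //.
by rewrite [LHS]/hk big_split /= mulrA.
Qed.

Lemma wmx_mul k c w d v : (0 < k)%N ->
  ltmx_mul (riordan_mx (kseries k c) (wmult k w))
           (riordan_mx (kseries k d) (wmult k v))
  = riordan_mx (kseries k (c * fps_comp d (hk k w))) (wmult k (wmul k w v)).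
Proof.
move=> k_gt0; apply/funext => i; apply/funext => j; rewrite /ltmx_mul.
rewrite (divn_eq i k) (divn_eq j k).
move: (i %/ k)%N (i %% k)%N (j %/ k)%N (j %% k)%N (ltn_pmod i k_gt0) (ltn_pmod j k_gt0).
move=> {i j} p s q r lt_sk lt_rk; rewrite coef_wmx //.
set A := riordan_mx _ (wmult k w); set B := riordan_mx _ (wmult k v).
have Abig l : (p * k + s < l)%N -> A (p * k + s)%N l = 0.
  move=> lt_l; rewrite (divn_eq l k) /A coef_wmx ?ltn_pmod //; case: eqP => // E.
  rewrite mulrC /hk exprMn -mulrA coefzXM leqNgt; case: ltnP => //.
  move=> le_p; move: lt_l; rewrite (divn_eq l k) -E ltn_add2r ltn_pmul2r // ltnNge.
  by rewrite le_p.
transitivity (\sum_(0 <= l < p.+1 * k) A (p * k + s)%N l * B l (q * k + r)%N).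
  rewrite big_mkord.
  apply: (@sum_widen F (fun l => A (p * k + s)%N l * B l (q * k + r)%N)) => l.
    by move=> lt_l; rewrite Abig ?mul0r.
  move=> le_l; rewrite Abig ?mul0r //; apply: leq_trans le_l.
  by rewrite mulSnr ltn_add2l.
rewrite big_nat_mul.
transitivity (\sum_(a < p.+1) if s == r then
   (c * \prod_(m < s) w m * hk k w ^+ a) p *
   (d * \prod_(m < r) v m * hk k v ^+ q) a else 0).
  rewrite ?big_mkord; apply: eq_bigr => a _.
  rewrite -[X in \sum_(X <= _ < _) _]add0n big_addn mulSnr addKn big_mkord.
  rewrite (bigD1 (Ordinal lt_sk)) //= big1 ?addr0.
    rewrite [(s + a * k)%N]addnC /A /B !coef_wmx // eqxx; case: eqP => // _; by rewrite mulr0.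
  move=> t /negPf ts; rewrite [(t + a * k)%N]addnC /A coef_wmx // eq_sym.
  by rewrite -[X in _ == X]/(val (Ordinal lt_sk)) val_eqE ts mul0r.
case: eqP => [->|_]; last by rewrite big1.
rewrite hk_mul -fps_compX ?coef_hk0 //.
have -> : c * fps_comp d (hk k w) * \prod_(m < r) wmul k w v m
    * fps_comp (hk k v ^+ q) (hk k w)
  = (c * \prod_(m < r) w m) *
    fps_comp (d * \prod_(m < r) v m * hk k v ^+ q) (hk k w).
  rewrite !fps_compM ?coef_hk0 // fps_comp_prod ?coef_hk0 // /wmul big_split /=.
  by rewrite -!mulrA; congr (_ * _); rewrite mulrCA.
by rewrite coefM_comp ?coef_hk0.
Qed.

Lemma wmx_one k : (0 < k)%N ->
  riordan_mx (kseries k 1) (wmult k (fun=> 1)) = ltmx_id.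
Proof.
move=> k_gt0; apply/funext => i; apply/funext => j.
rewrite [in LHS](divn_eq i k) [in LHS](divn_eq j k) coef_wmx ?ltn_pmod //.
rewrite /hk !big1 // !mul1r mulr1 coefzX /ltmx_id.
case: eqP => [e|ne]; last by case: eqP => // e; case: ne; rewrite e.
by rewrite {2}(divn_eq i k) {2}(divn_eq j k) e eqn_add2r eqn_pmul2r.
Qed.

(* The multiplication rule of the k-Riordan group, with any k-th root h of
   f_1 ... f_k; division by h is expressed by multiplying back. *)
Lemma riordan_mulE k g G h g' (f Fm f' : k.-tuple (fps F)) : (0 < k)%N ->
  is_kRiordan g f -> is_kRiordan G Fm ->
  fpsF1 h -> h ^+ k = \prod_(i < k) tnth f i ->
  g' = g * fps_comp G h ->
  (forall i, tnth f' i * h = tnth f i * fps_comp (tnth Fm i) h) ->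
  ltmx_mul (riordan_mx g f) (riordan_mx G Fm) = riordan_mx g' f'.
Proof.
move=> k_gt0 /(is_kRiordanP _ _ k_gt0)[c [w [c0 w0 -> ->]]].
move=> /(is_kRiordanP _ _ k_gt0)[d [v [d0 v0 -> ->]]] hF1 hE -> f'E.
have [z0 h0] := (zX0 k_gt0, hF1.1); rewrite wmx_mul //.
have hkE : h ^+ k = kseries k (hk k w).
  rewrite hE; under eq_bigr do rewrite tnth_mktuple.
  rewrite big_split /= prodr_const card_ord /kseries -fps_comp_prod //.
  by rewrite /hk fps_compM // fps_compz.
have compE u : fps_comp (kseries k u) h = kseries k (fps_comp u (hk k w)).
  rewrite /kseries !fps_compA ?coef_hk0 // fps_compX // fps_compz //.
  by rewrite hkE.
congr (riordan_mx _ _); first by rewrite compE /kseries fps_compM.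
apply: eq_from_tnth => i; apply: (fps_F1_cancel hF1).
rewrite [RHS]mulrC f'E !tnth_mktuple fps_compM // fps_compz // compE.
by rewrite /wmul /kseries fps_compM // [RHS]mulrCA !mulrA.
Qed.

Lemma wmulA k w v u : wmul k w (wmul k v u) = wmul k (wmul k w v) u.
Proof.
apply/funext => m; rewrite /wmul fps_compM ?coef_hk0 //.
by rewrite fps_compA ?coef_hk0 // -/(wmul k w v) hk_mul mulrA.
Qed.

Lemma wmul_F0 k w v : (forall m, fpsF0 (w m)) -> (forall m, fpsF0 (v m)) ->
  forall m, fpsF0 (wmul k w v m).
Proof. by move=> w0 v0 m; rewrite /fpsF0 coefM0 comp_coef0 mulf_neq0 //; [apply: w0|apply: v0]. Qed.

Lemma hk_F1 k w : (forall m, fpsF0 (w m)) -> fpsF1 (hk k w).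
Proof.
move=> w0; split; rewrite coefzM // coef_prod0.
by apply/prodf_neq0 => i _; apply: w0.
Qed.

Lemma winv_ex k c w : fpsF0 c -> (forall m, fpsF0 (w m)) ->
  exists d v, [/\ fpsF0 d, forall m, fpsF0 (v m),
    c * fps_comp d (hk k w) = 1 & wmul k w v = fun=> 1]
    /\ (forall m, w m = 1 -> v m = 1).
Proof.
move=> c0 w0.
have inv (a : fps F) : fpsF0 a -> exists b, fpsF0 b /\ a * fps_comp b (hk k w) = 1.
  move=> /fps_inv_ex[b ab1]; have [b' bE] := fps_comp_surj b (hk_F1 k w0).
  exists b'; rewrite bE; split=> //; apply/negP => /eqP b0.
  have /(congr1 (fun f : fps F => f 0%N)) := ab1.
  rewrite coefM0 -bE comp_coef0 b0 mulr0 => /esym/eqP.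
  by rewrite [_ == _](oner_eq0 F).
have [d [d0 dE]] := inv c c0.
have /choice[v vE] : forall m, exists b,
    [/\ fpsF0 b, w m * fps_comp b (hk k w) = 1 & w m = 1 -> b = 1].
  move=> m; have [wm1|wm1] := eqVneq (w m) 1.
    by exists 1; split; rewrite ?wm1 ?fps_comp1 ?mulr1 // /fpsF0 oner_eq0.
  by have [b [b0 bE]] := inv _ (w0 m); exists b; split=> // /eqP; rewrite (negPf wm1).
exists d, v; split=> [|m]; last by case: (vE m).
by split=> // [m|]; [case: (vE m) | apply/funext => m; case: (vE m)].
Qed.

(* A k-Riordan array is identified with its matrix. *)
Record kRiordan (k : nat) (k_gt0 : (0 < k)%N) := KRiordan {
  rmx : nat -> nat -> F;
  rmxP : exists g (f : k.-tuple (fps F)), is_kRiordan g f /\ rmx = riordan_mx g f }.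

End RiordanArrays.

Arguments riordan_mx {F k} g f.
Arguments is_kRiordan {F k} g f.

Section RiordanGroup.
Variables (F : fieldType) (k : nat) (k_gt0 : (0 < k)%N).
Local Notation R := (kRiordan F k_gt0).
Implicit Types A B C : R.

Lemma rmx_inj : injective (@rmx F k k_gt0).
Proof. by case=> A PA [B PB] /= E; subst B; rewrite (Prop_irrelevance PA PB). Qed.

HB.instance Definition _ := gen_eqMixin R.
HB.instance Definition _ := gen_choiceMixin R.

Lemma rmx_wP A : exists c w, [/\ fpsF0 c, forall m, fpsF0 (w m) &
  rmx A = riordan_mx (kseries k c) (wmult k w)].
Proof.
by case: (rmxP A) => g [f [/(is_kRiordanP _ _ k_gt0)[c [w [c0 w0 -> ->]]] ->]]; exists c, w.
Qed.

Lemma w_rmxP (c : fps F) w : fpsF0 c -> (forall m, fpsF0 (w m)) ->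
  exists g (f : k.-tuple (fps F)), is_kRiordan g f /\
    riordan_mx (kseries k c) (wmult k w) = riordan_mx g f.
Proof.
move=> c0 w0; exists (kseries k c), (wmult k w); split=> //.
by apply/is_kRiordanP => //; exists c, w.
Qed.

Fact kRiordan_one_subproof : exists g (f : k.-tuple (fps F)),
  is_kRiordan g f /\ ltmx_id F = riordan_mx g f.
Proof.
by rewrite -(wmx_one F k_gt0); apply: w_rmxP => [|m]; rewrite /fpsF0 oner_eq0.
Qed.

Fact kRiordan_mul_subproof A B : exists g (f : k.-tuple (fps F)),
  is_kRiordan g f /\ ltmx_mul (rmx A) (rmx B) = riordan_mx g f.
Proof.
have [c [w [c0 w0 ->]]] := rmx_wP A; have [d [v [d0 v0 ->]]] := rmx_wP B.
rewrite (wmx_mul _ _ _ _ k_gt0); apply: w_rmxP; last exact: wmul_F0.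
by rewrite /fpsF0 coefM0 comp_coef0 mulf_neq0.
Qed.

Definition kRiordan_one : R := KRiordan k_gt0 kRiordan_one_subproof.
Definition kRiordan_mul A B : R := KRiordan k_gt0 (kRiordan_mul_subproof A B).

Fact kRiordan_mulA : associative kRiordan_mul.
Proof.
move=> A B C; apply: rmx_inj => /=.
have [a [u [a0 u0 ->]]] := rmx_wP A; have [b [v [b0 v0 ->]]] := rmx_wP B.
have [c [w [c0 w0 ->]]] := rmx_wP C.
rewrite !(wmx_mul _ _ _ _ k_gt0) wmulA hk_mul.
by rewrite fps_compM ?coef_hk0 // fps_compA ?coef_hk0 // mulrA.
Qed.

Fact kRiordan_mul1 : left_id kRiordan_one kRiordan_mul.
Proof.
move=> A; apply: rmx_inj => /=; apply/funext => i; apply/funext => j.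
rewrite /ltmx_mul /ltmx_id big_ord_recr /= eqxx mul1r big1 ?add0r // => l _.
by rewrite gtn_eqF ?mul0r.
Qed.

Fact kRiordan_inv_ex A : exists B, kRiordan_mul A B = kRiordan_one.
Proof.
have [c [w [c0 w0 AE]]] := rmx_wP A.
have [d [v [[d0 v0 cd wv] _]]] := winv_ex k c0 w0.
exists (KRiordan k_gt0 (w_rmxP d0 v0)); apply: rmx_inj.
by rewrite /= AE (wmx_mul _ _ _ _ k_gt0) cd wv wmx_one.
Qed.

Fact kRiordan_mulr1 : right_id kRiordan_one kRiordan_mul.
Proof.
move=> A; have [c [w [c0 w0 AE]]] := rmx_wP A; apply: rmx_inj => /=.
rewrite AE -(wmx_one F k_gt0) (wmx_mul _ _ _ _ k_gt0) fps_comp1 mulr1.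
by congr (riordan_mx _ (wmult k _)); apply/funext => m; rewrite /wmul fps_comp1 mulr1.
Qed.

Definition kRiordan_inv A : R := projT1 (cid (kRiordan_inv_ex A)).

Fact kRiordan_mulV : right_inverse kRiordan_one kRiordan_inv kRiordan_mul.
Proof. by move=> A; rewrite /kRiordan_inv; case: cid. Qed.

Fact kRiordan_Vmul : left_inverse kRiordan_one kRiordan_inv kRiordan_mul.
Proof.
move=> A; rewrite -[RHS](kRiordan_mulV (kRiordan_inv A)); congr kRiordan_mul.
rewrite -[RHS]kRiordan_mul1 -(kRiordan_mulV A) -kRiordan_mulA.
by rewrite kRiordan_mulV kRiordan_mulr1.
Qed.

HB.instance Definition _ := isGroup.Build R
  kRiordan_mulA kRiordan_mul1 kRiordan_mulr1 kRiordan_Vmul kRiordan_mulV.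

End RiordanGroup.

Local Open Scope group_scope.

Lemma rmxM (F : fieldType) k (k_gt0 : (0 < k)%N) (A B : kRiordan F k_gt0) :
  rmx (A * B) = ltmx_mul (rmx A) (rmx B).
Proof. by []. Qed.

Definition double_riordan (F : fieldType) := kRiordan F (isT : (0 < 2)%N).
Definition triple_riordan (F : fieldType) := kRiordan F (isT : (0 < 3)%N).
HB.instance Definition _ F := Group.on (double_riordan F).
HB.instance Definition _ F := Group.on (triple_riordan F).

Section AlmostAppell.
Variables (F : fieldType) (j : 'I_3).

(* The multiplier z in position j + 1, the multipliers a, b in the other two. *)
Definition insert_z (a b : fps F) : 3.-tuple (fps F) :=
  match val j with
  | 0%N => [tuple zvar F; a; b]
  | 1%N => [tuple a; zvar F; b]
  | _ => [tuple a; b; zvar F]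
  end.

Definition almost_appell_set : {pred triple_riordan F} := fun A =>
  `[< exists g f1 f2 : fps F, [/\ fpsF0 g, fpsF1 f1, fpsF1 f2 &
        rmx A = riordan_mx (kseries 3 g) (insert_z (kmult 3 f1) (kmult 3 f2))] >].

Lemma almost_appellP (A : triple_riordan F) :
  reflect (exists c w, [/\ fpsF0 c, forall m, fpsF0 (w m), w (val j) = 1%R &
             rmx A = riordan_mx (kseries 3 c) (wmult 3 w)])
    (A \in almost_appell_set).
Proof.
have z1 : zvar F = (zvar F * kseries 3 1)%R by rewrite /kseries fps_comp1 mulr1.
have F01 : fpsF0 (1%R : fps F) by rewrite /fpsF0 oner_eq0.
have F1z u : fpsF0 u -> fpsF1 (zvar F * u)%R by move=> u0; split; rewrite coefzM.
apply: (iffP (asboolP _)) => [[g [f1 [f2 [g0 f10 f20 ->]]]]|[c [w [c0 w0 wj ->]]]].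
  have [[f1z f1n] [f2z f2n]] := (f10, f20); rewrite !kmultE //.
  set u := fps_divz 1 f1; set v := fps_divz 1 f2.
  have [u0 v0] : fpsF0 u /\ fpsF0 v by split.
  pose s := match val j with
    0%N => [:: 1%R; u; v] | 1%N => [:: u; 1%R; v] | _ => [:: u; v; 1%R] end.
  exists g, (fun m => nth 1%R s m); split=> //; rewrite /s /insert_z.
  - by case: (j) => [[|[|[|//]]]] _ [|[|[|m]]] //=; rewrite nth_nil.
  - by case: (j) => [[|[|[|//]]]].
  congr riordan_mx; apply: eq_from_tnth => i; rewrite tnth_mktuple (tnth_nth 0%R).
  by case: (j) (i) => [[|[|[|//]]]] ? [[|[|[|//]]]] ?.
exists c, (zvar F * w (if val j == 0%N then 1%N else 0%N))%R,
  (zvar F * w (if val j == 2%N then 1%N else 2%N))%R.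
split=> //; do 1?[exact: F1z]; rewrite !kmult_z // /insert_z.
congr riordan_mx; apply: eq_from_tnth => i; rewrite tnth_mktuple (tnth_nth 0%R).
by case: (j) wj (i) => [[|[|[|//]]]] ? /= wj [[|[|[|//]]]] ? //=; rewrite wj.
Qed.

Fact almost_appell_closed : group_closed almost_appell_set.
Proof.
split=> [|A B /almost_appellP[c [w [c0 w0 wj AE]]]].
  apply/almost_appellP; exists 1%R, (fun=> 1%R).
  by split=> [|m||]; rewrite ?wmx_one // /fpsF0 oner_eq0.
case/almost_appellP=> d [v [d0 v0 vj BE]].
have [e [u [[e0 u0 de vu] u1]]] := winv_ex 3 d0 v0.
pose C : triple_riordan F := KRiordan _ (w_rmxP (isT : (0 < 3)%N) e0 u0).
have -> : B^-1 = C.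
  apply: (mulgI B); rewrite mulgV; apply: rmx_inj.
  by rewrite rmxM BE (wmx_mul _ _ _ _ (isT : (0 < 3)%N)) de vu wmx_one.
apply/almost_appellP; exists (c * fps_comp e (hk 3 w))%R, (wmul 3 w u); split.
- by rewrite /fpsF0 coefM0 comp_coef0 mulf_neq0.
- exact: wmul_F0.
- by rewrite /wmul wj (u1 _ vj) fps_comp1 mulr1.
by rewrite rmxM AE (wmx_mul _ _ _ _ (isT : (0 < 3)%N)).
Qed.

Record almost_appell := AlmostAppell {
  aa_val :> triple_riordan F; _ : aa_val \in almost_appell_set }.
HB.instance Definition _ := [isSub for aa_val].
HB.instance Definition _ := [Choice of almost_appell by <:].
HB.instance Definition _ := SubChoice_isSubGroup.Build _ _ almost_appell almost_appell_closed.
End AlmostAppell.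

Definition group_isomorphic (G H : groupType) : Prop :=
  exists phi : {multiplicative G -> H}, bijective phi.

(* Main.v *)
(* Write a k-Riordan array as g = c(z^k), f_i = z w_i(z^k) with c, w_i in F_0.
   Its matrix determines c, w_0, ..., w_(k-1), and the product of (c, w) and
   (d, v) is (c d(H), w_i v_i(H)) with H = z w_0 ... w_(k-1).  Inserting a
   multiplier z means inserting a factor w_j = 1, which changes neither H nor the
   other entries of a product; so (c, w) |-> (c, w with 1 inserted) is an injective
   morphism from the k-Riordan to the (k+1)-Riordan group, with image the arrays
   whose multiplier in position j is z. *)
From HB Require Import structures.
Require Import Defs.
From mathcomp Require Import all_boot all_order all_algebra.
From mathcomp Require Import boolp reals.
From mathcomp Require Import complex.

Set Implicit Arguments.
Unset Strict Implicit.
Unset Printing Implicit Defensive.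

Import GRing.Theory.
Local Open Scope ring_scope.

(** * Uniqueness of the parameters of a Riordan array *)

Lemma fps_F0_cancel (F : fieldType) (u : fps F) : fpsF0 u -> injective ( *%R u).
Proof.
move=> /fps_inv_ex[v uv] a b E.
by rewrite -[a]mul1r -[b]mul1r -uv ![u * v]mulrC -!mulrA E.
Qed.

(** Columns 0 to k reveal the partial products of c, w_0, ..., w_(k-1), and consecutive partial
    products differ by one w_m; factors in F_0 can be cancelled. *)
Lemma riordan_mx_inj (F : fieldType) k (c d : fps F) w v : (0 < k)%N ->
  fpsF0 c -> (forall m, fpsF0 (w m)) ->
  riordan_mx (kseries k c) (wmult k w) = riordan_mx (kseries k d) (wmult k v) ->
  c = d /\ forall m, (m < k)%N -> w m = v m.
Proof.
move=> k_gt0 c0 w0 E.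
have colE r : (r <= k)%N -> c * \prod_(m < r) w m = d * \prod_(m < r) v m.
  rewrite leq_eqVlt => /predU1P[->|lt_rk].
    (* Column k starts the second period: its rows p * k carry the coefficients of [c * hk k w],
       hence the additional factor z. *)
    apply: zvar_inj; rewrite /= !(mulrCA (zvar F)) -/(hk k w) -/(hk k v).
    apply: fpsP => p; have := congr1 (fun M => M (p * k + 0)%N (1 * k + 0)%N) E.
    by rewrite !coef_wmx // eqxx !big_ord0 !mulr1 !expr1.
  apply: fpsP => p; have := congr1 (fun M => M (p * k + r)%N (0 * k + r)%N) E.
  by rewrite !coef_wmx // eqxx !expr0 !mulr1.
split=> [|m lt_mk]; first by have := colE 0%N isT; rewrite !big_ord0 !mulr1.
apply: (@fps_F0_cancel _ (c * \prod_(i < m) w i)).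
  by rewrite /fpsF0 coefM0 coef_prod0 mulf_neq0 //; apply/prodf_neq0 => i _; apply: w0.
have := colE _ lt_mk; rewrite !big_ord_recr !mulrA /= => ->.
by rewrite (colE _ (ltnW lt_mk)).
Qed.

(** * Inserting a factor 1 at position j *)

Definition insert_one (F : fieldType) (j : nat) (w : nat -> fps F) (m : nat) : fps F :=
  if m == j then 1 else w (unbump j m).

Lemma insert_one_bump (F : fieldType) j (w : nat -> fps F) m :
  insert_one j w (bump j m) = w m.
Proof. by rewrite /insert_one eq_sym (negPf (neq_bump _ _)) bumpK. Qed.

Lemma bump_insert_one (F : fieldType) j (w : nat -> fps F) :
  w j = 1 -> insert_one j (fun m => w (bump j m)) = w.
Proof.
move=> wj; apply/funext => m; rewrite /insert_one.
by case: eqP => [->//|/eqP nmj]; rewrite unbumpK.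
Qed.

Lemma insert_one_F0 (F : fieldType) j (w : nat -> fps F) :
  (forall m, fpsF0 (w m)) -> forall m, fpsF0 (insert_one j w m).
Proof. by move=> w0 m; rewrite /insert_one; case: ifP; rewrite // /fpsF0 oner_eq0. Qed.

(** This makes insertion multiplicative: products of size k and k + 1 substitute the same series
    H. *)
Lemma hk_insert_one (F : fieldType) k (j : 'I_k.+1) (w : nat -> fps F) :
  hk k.+1 (insert_one j w) = hk k w.
Proof.
rewrite /hk (bigD1_ord j) //= {1}/insert_one eqxx mul1r.
by under eq_bigr do rewrite insert_one_bump.
Qed.

Lemma wmul_insert_one (F : fieldType) k (j : 'I_k.+1) (w v : nat -> fps F) :
  wmul k.+1 (insert_one j w) (insert_one j v) = insert_one j (wmul k w v).
Proof.
apply/funext => m; rewrite /wmul hk_insert_one /insert_one.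
by case: ifP => // _; rewrite fps_comp1 mulr1.
Qed.

(* k1_gt0 is a variable because the type kRiordan depends on the proof of
   positivity, which is isT for the Triple Riordan group. *)
Section InsertZ.
Variables (F : fieldType) (k : nat) (k_gt0 : (0 < k)%N) (k1_gt0 : (0 < k.+1)%N).
Variable j : 'I_k.+1.
Local Notation W n c w := (riordan_mx (kseries n c) (wmult n w)).

(** An array is only a matrix, so the parameters must be read back from it. B is built from one
    choice of them; any other choice has the same c and agrees with w below k, and the columns of B
    depend on nothing else. *)
Fact insert_column_ex (A : kRiordan F k_gt0) : exists B : kRiordan F k1_gt0,
  forall c w, fpsF0 c -> (forall m, fpsF0 (w m)) ->
  rmx A = W k c w -> rmx B = W k.+1 c (insert_one j w).
Proof.
have [c [w [c0 w0 AE]]] := rmx_wP A.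
exists (KRiordan k1_gt0 (w_rmxP k1_gt0 c0 (insert_one_F0 j w0))) => d v d0 v0.
rewrite AE => /(riordan_mx_inj k_gt0 c0 w0)[<- wv] /=; congr riordan_mx.
apply: eq_from_tnth => i; rewrite !tnth_mktuple; congr (_ * kseries _ _).
have [i' ->|->] := unliftP j i; first by rewrite !insert_one_bump wv.
by rewrite /insert_one eqxx.
Qed.

Definition insert_column (A : kRiordan F k_gt0) := projT1 (cid (insert_column_ex A)).

Lemma insert_columnE A c w : fpsF0 c -> (forall m, fpsF0 (w m)) ->
  rmx A = W k c w -> rmx (insert_column A) = W k.+1 c (insert_one j w).
Proof. exact: (projT2 (cid (insert_column_ex A))). Qed.

Lemma insert_columnM : {morph insert_column : A B / (A * B)%g}.
Proof.
move=> A B; have [c [w [c0 w0 AE]]] := rmx_wP A.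
have [d [v [d0 v0 BE]]] := rmx_wP B; apply: rmx_inj.
rewrite rmxM (insert_columnE c0 w0 AE) (insert_columnE d0 v0 BE) wmx_mul //.
rewrite hk_insert_one wmul_insert_one; apply: insert_columnE.
- by rewrite /fpsF0 coefM0 comp_coef0 mulf_neq0.
- exact: wmul_F0.
by rewrite rmxM AE BE wmx_mul.
Qed.

Lemma insert_column_inj : injective insert_column.
Proof.
move=> A B; have [c [w [c0 w0 AE]]] := rmx_wP A.
have [d [v [d0 v0 BE]]] := rmx_wP B.
move=> /(congr1 (@rmx _ _ _)).
rewrite (insert_columnE c0 w0 AE) (insert_columnE d0 v0 BE).
move=> /(riordan_mx_inj k1_gt0 c0 (insert_one_F0 j w0))[cd wv].
apply: rmx_inj; rewrite AE BE cd; congr riordan_mx.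
apply: eq_from_tnth => i; rewrite !tnth_mktuple; congr (_ * kseries _ _).
by have := wv _ (ltn_ord (lift j i)); rewrite !insert_one_bump.
Qed.

(** The preimage is obtained by deleting entry j, which [bump j] skips. *)
Lemma insert_column_onto (B : kRiordan F k1_gt0) c (w : nat -> fps F) :
  fpsF0 c -> (forall m, fpsF0 (w m)) -> w j = 1 -> rmx B = W k.+1 c w ->
  exists A, insert_column A = B.
Proof.
move=> c0 w0 wj BE; pose v m := w (bump j m).
have v0 m : fpsF0 (v m) by apply: w0.
exists (KRiordan k_gt0 (w_rmxP k_gt0 c0 v0)); apply: rmx_inj.
by rewrite (insert_columnE c0 v0) // bump_insert_one.
Qed.
End InsertZ.

(** * The Double Riordan group and the three almost Appell subgroups *)

Section Double.
Variable F : fieldType.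

Definition chi (j : 'I_3) (A : double_riordan F) : triple_riordan F :=
  @insert_column F 2 isT isT j A.

Lemma chiM j : {morph chi j : A B / (A * B)%g}.
Proof. exact: insert_columnM. Qed.

HB.instance Definition _ j := isMultiplicative.Build _ _ (chi j) (chiM j).

Lemma chi_almost_appell j A : chi j A \in almost_appell_set j.
Proof.
have [c [w [c0 w0 AE]]] := rmx_wP A; apply/almost_appellP.
exists c, (insert_one j w); split=> //; first exact: insert_one_F0.
  by rewrite /insert_one eqxx.
exact: insert_columnE.
Qed.

Definition chi_iso j (A : double_riordan F) : almost_appell F j :=
  AlmostAppell (chi_almost_appell j A).

Lemma chi_isoM j : {morph chi_iso j : A B / (A * B)%g}.
Proof. by move=> A B; apply: val_inj; rewrite /= chiM. Qed.

HB.instance Definition _ j := isMultiplicative.Build _ _ (chi_iso j) (chi_isoM j).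

Lemma chi_iso_bij j : bijective (chi_iso j).
Proof.
have onto (B : almost_appell F j) : exists A, chi_iso j A = B.
  have /almost_appellP[c [w [c0 w0 wj BE]]] := valP B.
  have [A AB] := insert_column_onto (isT : (0 < 2)%N) c0 w0 wj BE.
  by exists A; apply: val_inj.
(* A right inverse of an injective map is also a left inverse. *)
have /choice[psi psiK] := onto; exists psi => // A.
by apply: (@insert_column_inj F 2 isT isT j); apply: (congr1 val (psiK (chi_iso j A))).
Qed.

Lemma wmult2E (f1 f2 : fps F) : f1 0%N = 0 -> f2 0%N = 0 ->
  [tuple kmult 2 f1; kmult 2 f2] = wmult 2 (nth 1 [:: fps_divz 1 f1; fps_divz 1 f2]).
Proof.
move=> z1 z2; apply: eq_from_tnth => i; rewrite tnth_mktuple (tnth_nth 0).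
by case: i => [[|[|//]]] ?; rewrite /= kmultE.
Qed.

Lemma nth_fps_divz_F0 (f1 f2 : fps F) : fpsF1 f1 -> fpsF1 f2 ->
  forall m, fpsF0 (nth 1 [:: fps_divz 1 f1; fps_divz 1 f2] m).
Proof.
move=> [_ f10] [_ f20] [|[|m]] //=.
by rewrite nth_nil /fpsF0 oner_eq0.
Qed.

Lemma is_kRiordan2 (g f1 f2 : fps F) : fpsF0 g -> fpsF1 f1 -> fpsF1 f2 ->
  is_kRiordan (kseries 2 g) [tuple kmult 2 f1; kmult 2 f2].
Proof.
move=> g0 f10 f20; split=> [|[[|[|//]]] i2]; first by exists g.
  by exists f1.
by exists f2.
Qed.

Lemma rmx2P (A : double_riordan F) : exists g f1 f2 : fps F,
  [/\ fpsF0 g, fpsF1 f1, fpsF1 f2 &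
      rmx A = riordan_mx (kseries 2 g) [tuple kmult 2 f1; kmult 2 f2]].
Proof.
have [g [f [[[c c0 ->] fE] ->]]] := rmxP A.
have [f1 f10 f1E] := fE (@Ordinal 2 0 isT); have [f2 f20 f2E] := fE (@Ordinal 2 1 isT).
exists c, f1, f2; split=> //; congr riordan_mx; apply: eq_from_tnth => i.
case: i => [[|[|//]]] i2; [rewrite -[RHS]f1E|rewrite -[RHS]f2E];
  by congr (tnth f _); apply: val_inj.
Qed.

(** The parameters f_1 / z and f_2 / z serve both for k = 2 and for k = 3, so inserting 1 in front
    yields exactly the formula for the map. *)
Lemma chi0E (g f1 f2 : fps F) (A : double_riordan F) :
  fpsF0 g -> fpsF1 f1 -> fpsF1 f2 ->
  rmx A = riordan_mx (kseries 2 g) [tuple kmult 2 f1; kmult 2 f2] ->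
  rmx (chi ord0 A) =
    riordan_mx (kseries 3 g) [tuple zvar F; kmult 3 f1; kmult 3 f2].
Proof.
move=> g0 f10 f20; have [[z1 _] [z2 _]] := (f10, f20); rewrite wmult2E // => AE.
rewrite (insert_columnE (isT : (0 < 3)%N) ord0 g0 (nth_fps_divz_F0 f10 f20) AE).
congr riordan_mx; apply: eq_from_tnth => i; rewrite tnth_mktuple (tnth_nth 0).
case: i => [[|[|[|//]]]] ?; rewrite /insert_one /= ?kmultE //.
(* The inserted multiplier is z times the constant series 1 taken at z^3. *)
by rewrite /kseries fps_comp1 mulr1.
Qed.

End Double.

Theorem theorem2p2 (R : realType) :
  (forall g f1 f2 : fps R[i], fpsF0 g -> fpsF1 f1 -> fpsF1 f2 ->
     is_kRiordan (kseries 2 g) [tuple kmult 2 f1; kmult 2 f2]) /\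
  (forall A : double_riordan R[i], exists g f1 f2 : fps R[i],
     [/\ fpsF0 g, fpsF1 f1, fpsF1 f2 &
         rmx A = riordan_mx (kseries 2 g) [tuple kmult 2 f1; kmult 2 f2]]) /\
  (exists chi : {multiplicative double_riordan R[i] -> triple_riordan R[i]},
     (forall (g f1 f2 : fps R[i]) (A : double_riordan R[i]),
        fpsF0 g -> fpsF1 f1 -> fpsF1 f2 ->
        rmx A = riordan_mx (kseries 2 g) [tuple kmult 2 f1; kmult 2 f2] ->
        rmx (chi A) =
          riordan_mx (kseries 3 g) [tuple zvar R[i]; kmult 3 f1; kmult 3 f2]) /\
     injective chi) /\
  (forall j : 'I_3,
     group_isomorphic (double_riordan R[i]) (almost_appell R[i] j)).
Proof.
split; first exact: is_kRiordan2.
split; first exact: rmx2P.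
split=> [|j]; last by exists (@chi_iso R[i] j); apply: chi_iso_bij.
exists (@chi R[i] ord0); split; first exact: chi0E.
exact: insert_column_inj.
Qed.
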